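(* There exists a post-quantum sparse pseudorandom distribution, i.e., an ensemble $\{D_\lambda\}_{\lambda\in\mathbb{N}}$, where each $D_\lambda$ is a probability distribution on $\{0,1\}^\lambda$, such that: (Sparseness) $|\mathsf{supp}(D_\lambda)|/2^\lambda = \mathsf{negl}(\lambda)$; and (Non-uniform post-quantum pseudorandomness) for every non-uniform QPT distinguisher $\{\mathcal{A}_\lambda,\rho_\lambda\}_{\lambda\in\mathbb{N}}$, $$\left|\Pr_{y\gets D_\lambda}[\mathcal{A}_\lambda(\rho_\lambda,y)=1]-\Pr_{y'\gets\{0,1\}^\lambda}[\mathcal{A}_\lambda(\rho_\lambda,y')=1]\right|=\mathsf{negl}(\lambda).$$
   Context: A non-uniform QPT algorithm $\{\mathcal{A}_\lambda,\rho_\lambda\}_{\lambda\in\mathbb{N}}$ consists, for each $\lambda$, of a quantum circuit $\mathcal{A}_\lambda$ of size $\mathrm{poly}(\lambda)$ and a quantum advice state $\rho_\lambda$ on $\mathrm{poly}(\lambda)$ qubits (arbitrary, not necessarily efficiently preparable). The distributions $D_\lambda$ are not required to be efficiently samplable. $\mathsf{negl}$ denotes a negligible function. *)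

(* Defs.v *)
From HB Require Import structures.
From mathcomp Require Import all_boot all_order all_algebra.
From mathcomp Require Import reals complex.
Set Implicit Arguments. Unset Strict Implicit. Unset Printing Implicit Defensive.
Import Order.TTheory GRing.Theory Num.Theory.
Local Open Scope ring_scope.

Section Quantum.
Variable R : realType.
Local Notation C := R[i].

Definition bits (n : nat) := {ffun 'I_n -> bool}.
Definition qdim (n : nat) := #|{: bits n}|.
(* Operators on n qubits, indexed by computational basis states via enum_val. *)
Definition qop (n : nat) := 'M[C]_(qdim n).
Definition mx_of n (f : bits n -> bits n -> C) : qop n :=
  \matrix_(i, j) f (enum_val i) (enum_val j).
Definition entry n (A : qop n) (x y : bits n) : C := A (enum_rank x) (enum_rank y).

Definition adjoint n (A : qop n) : qop n := (map_mx conjc A)^T.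

Definition density_matrix n (rho : qop n) : Prop :=
  adjoint rho = rho /\
  (forall v : 'cV[C]_(qdim n), 0 <= ((map_mx conjc v)^T *m rho *m v) 0 0) /\
  \tr rho = 1.

(* Universal gate set {H, T, CNOT} acting on wires 'I_w. *)
Inductive gate (w : nat) : Type :=
| GH of 'I_w
| GT of 'I_w
| GCNOT of 'I_w & 'I_w. (* control, target *)

Definition gate_wf w (g : gate w) : bool :=
  if g is GCNOT c t then c != t else true.

Definition agree_except w (i : 'I_w) (x y : bits w) : bool :=
  [forall j, (j != i) ==> (x j == y j)].

Definition sqrt2 : C := real_complex R (Num.sqrt (2 : R)).

(* Matrix of a gate: entry (x, y) is <x| G |y>. *)
Definition gate_mx w (g : gate w) : qop w :=
  match g with
  | GH i => mx_of (fun x y => if agree_except i x y then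
                     (if x i && y i then - 1 else 1) / sqrt2 else 0)
  | GT i => mx_of (fun x y => if x == y then
                     (if x i then (1 + 'i%C) / sqrt2 else 1) else 0)
  | GCNOT c t => mx_of (fun x y => if agree_except t x y &&
                     (x t == (y t (+) y c)) then 1 else 0)
  end.

Definition circ_mx w (gs : seq (gate w)) : qop w :=
  foldl (fun U g => gate_mx g *m U) 1%:M gs.

Definition adv_part a n m (x : bits (a + (n + m))) : bits a :=
  [ffun i => x (lshift (n + m) i)].
Definition inp_part a n m (x : bits (a + (n + m))) : bits n :=
  [ffun i => x (rshift a (lshift m i))].
Definition anc_part a n m (x : bits (a + (n + m))) : bits m :=
  [ffun i => x (rshift a (rshift n i))].

(* Initial state  rho (x) |y><y| (x) |0^m><0^m|. *)
Definition init_state a n m (rho : qop a) (y : bits n) : qop (a + (n + m)) :=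
  mx_of (fun x x' =>
    entry rho (adv_part x) (adv_part x') *
    ((inp_part x == y) && (inp_part x' == y) &&
     (anc_part x == [ffun=> false]) && (anc_part x' == [ffun=> false]))%:R).

Record qalg (n : nat) := QAlg {
  qa_adv : nat;
  qa_anc : nat;
  qa_gates : seq (gate (qa_adv + (n + qa_anc)));
  qa_out : 'I_(qa_adv + (n + qa_anc));
  qa_rho : qop qa_adv
}.

Definition qalg_wf n (A : qalg n) : Prop :=
  all (@gate_wf _) (qa_gates A) /\ density_matrix (qa_rho A).

Definition qalg_size n (A : qalg n) : nat :=
  qa_adv A + qa_anc A + size (qa_gates A).

(* Pr[A(rho, y) = 1]: measure qubit qa_out of U (rho (x) |y><y| (x) |0><0|) U^dagger
   in the computational basis. *)
Definition accept_prob n (A : qalg n) (y : bits n) : R :=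
  let U := circ_mx (qa_gates A) in
  let sigma := U *m init_state (qa_anc A) (qa_rho A) y *m adjoint U in
  complex.Re (\sum_(x : bits _ | x (qa_out A)) entry sigma x x).

Definition nu_qpt (Af : forall n, qalg n) : Prop :=
  (forall n, qalg_wf (Af n)) /\
  exists k : nat, forall n, (qalg_size (Af n) <= n.+2 ^ k)%N.

Definition negligible (f : nat -> R) : Prop :=
  forall c : nat, exists N : nat, forall n : nat, (N <= n)%N ->
    `|f n| < (n%:R ^+ c)^-1.

Definition distribution n (D : {ffun bits n -> R}) : Prop :=
  (forall y, 0 <= D y) /\ \sum_y D y = 1.

Definition supp n (D : {ffun bits n -> R}) := [set y | D y != 0].

End Quantum.

(* Main.v *)
(** Draw T = 2^Theta(n) strings y_1, ..., y_T of length n independently and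
    uniformly, with T much smaller than 2^n, and let D be their empirical
    distribution. For a fixed circuit with advice rho, the acceptance probability
    on y is tr(rho M_y) for a Hermitian contraction M_y, so the distinguishing
    advantage is tr(rho X), where X is the average of the centered matrices
    X_(y_i) with X_y := M_y - E M.
    The advice is eliminated by Cauchy-Schwarz: tr(rho X)^2 <= tr(rho X^2), and
    by iteration tr(rho X)^q <= tr(X^q) for every power q of 2 above 1. In
    E tr((sum_i X_(y_i))^q) a word in the X_(y_i) contributes only if no letter
    occurs exactly once, and there are at most T^(q/2) (q/2)^q such words. This
    makes the moment so small that a union bound over all circuits of size
    2^Theta(n) succeeds with q = 2^Theta(n). *)

Require Import Defs.
From HB Require Import structures.
From mathcomp Require Import all_boot all_order all_algebra.
From mathcomp Require Import reals complex ring zify.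
From mathcomp Require boolp.
Set Implicit Arguments. Unset Strict Implicit. Unset Printing Implicit Defensive.
Import Order.TTheory GRing.Theory Num.Theory.
Local Open Scope ring_scope.

Local Notation "A ^H" := ((map_mx Num.conj A)^T)
  (at level 8, format "A ^H") : ring_scope.

(** * Hermitian matrices, positive semidefinite functionals and contractions *)

Section HermitianMatrices.
Variable C : numClosedFieldType.

Lemma adjM m n p (A : 'M[C]_(m, n)) (B : 'M_(n, p)) :
  (A *m B)^H = B^H *m A^H.
Proof. by rewrite map_mxM trmx_mul. Qed.

Lemma adjK m n (A : 'M[C]_(m, n)) : (A^H)^H = A.
Proof. by apply/matrixP => i j; rewrite !mxE conjCK. Qed.

Lemma adjB m n (A B : 'M[C]_(m, n)) : (A - B)^H = A^H - B^H.
Proof. by apply/matrixP => i j; rewrite !mxE rmorphB. Qed.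

Lemma adj_sum m n (I : finType) (A : I -> 'M[C]_(m, n)) :
  (\sum_i A i)^H = \sum_i (A i)^H.
Proof.
apply/matrixP => i j; rewrite !mxE !summxE rmorph_sum.
by apply: eq_bigr => k _; rewrite !mxE.
Qed.

Lemma adjZ m n a (A : 'M[C]_(m, n)) : (a *: A)^H = a^* *: A^H.
Proof. by apply/matrixP => i j; rewrite !mxE rmorphM. Qed.

Lemma adj_scalar n (a : C) : (a%:M : 'M[C]_n)^H = a^*%:M.
Proof. by rewrite map_scalar_mx tr_scalar_mx. Qed.

Lemma adjX n (X : 'M[C]_n) q : X^H = X -> (X ^+ q)^H = X ^+ q.
Proof.
move=> hX; elim: q => [|q IH]; first by rewrite !expr0 map_mx1 trmx1.
by rewrite {1}exprS -mulmxE adjM IH hX mulmxE -exprSr.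
Qed.

Lemma mxtrace_adj n (A : 'M[C]_n) : \tr A^H = (\tr A)^*.
Proof. by rewrite mxtrace_tr rmorph_sum; apply: eq_bigr => i _; rewrite mxE. Qed.

Definition norm2 n (v : 'cV[C]_n) : C := \sum_i `|v i 0| ^+ 2.

Lemma norm2_ge0 n (v : 'cV[C]_n) : 0 <= norm2 v.
Proof. by apply: sumr_ge0 => i _; rewrite exprn_ge0. Qed.

Lemma norm2E n (v : 'cV[C]_n) : norm2 v = (v^H *m v) 0 0.
Proof. by rewrite mxE; apply: eq_bigr => i _; rewrite !mxE normCKC. Qed.

Definition psd n (rho : 'M[C]_n) : Prop :=
  forall v : 'cV[C]_n, 0 <= (v^H *m rho *m v) 0 0.

Lemma quadE n (rho : 'M[C]_n) (v : 'cV[C]_n) :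
  (v^H *m rho *m v) 0 0 = \sum_i \sum_j (v i 0)^* * rho i j * v j 0.
Proof.
rewrite exchange_big mxE; apply: eq_bigr => j _.
by rewrite !mxE big_distrl; apply: eq_bigr => i _; rewrite !mxE.
Qed.

Lemma mxtrace_cols m n (rho : 'M[C]_m) (Z : 'M[C]_(m, n)) :
  \tr (rho *m (Z *m Z^H)) = \sum_j ((col j Z)^H *m rho *m col j Z) 0 0.
Proof.
rewrite mulmxA mxtrace_mulC mulmxA; apply: eq_bigr => j _.
rewrite !mxE; apply: eq_bigr => i _; rewrite !mxE; congr (_ * _).
by apply: eq_bigr => k _; rewrite !mxE.
Qed.

(* With u_ij = conj(v_j) e_i - conj(v_i) e_j, the sum of the u_ij^H rho u_ij is
   twice the difference of the two sides. *)
Lemma psd_le_trace n (rho : 'M[C]_n) (v : 'cV[C]_n) :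
  psd rho -> (v^H *m rho *m v) 0 0 <= \tr rho * norm2 v.
Proof.
move=> hr.
pose S := \sum_i \sum_j (`|v j 0| ^+ 2 * rho i i + `|v i 0| ^+ 2 * rho j j
   - (v i 0)^* * rho i j * v j 0 - (v j 0)^* * rho j i * v i 0).
have S0 : 0 <= S.
  apply: sumr_ge0 => i _; apply: sumr_ge0 => j _.
  have := hr ((v j 0)^* *: delta_mx i 0 - (v i 0)^* *: delta_mx j 0).
  set u := (X in X^H); suff -> : (u^H *m rho *m u) 0 0 =
    `|v j 0| ^+ 2 * rho i i + `|v i 0| ^+ 2 * rho j j
    - (v i 0)^* * rho i j * v j 0 - (v j 0)^* * rho j i * v i 0 by [].
  have E (k l : 'I_n) : (delta_mx k 0 : 'cV[C]_n)^H *m rho *m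
     (delta_mx l 0 : 'cV[C]_n) = (rho k l)%:M.
    rewrite map_delta_mx trmx_delta -rowE -colE; apply/matrixP => x y.
    by rewrite !ord1 !mxE eqxx mulr1n.
  rewrite /u adjB !adjZ !conjCK !mulmxBl !mulmxBr -!scalemxAl -!scalemxAr.
  rewrite -?scalemxAl !E !mxE !mulr1n !normCK. ring.
move: S0; rewrite /S.
under eq_bigr do rewrite !big_split /= !sumrN -mulr_suml -mulr_sumr.
rewrite !big_split /= !sumrN -mulr_sumr -mulr_suml.
rewrite [X in _ - X](exchange_big) -!/(norm2 v) -!/(mxtrace rho) -quadE.
have -> (a b : C) : a + a - b - b = (a - b) *+ 2 by ring.
by rewrite pmulrn_lge0 // subr_ge0 mulrC.
Qed.

Lemma psd_trace_ge0 m n (rho : 'M[C]_m) (Z : 'M[C]_(m, n)) :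
  psd rho -> 0 <= \tr (rho *m (Z *m Z^H)).
Proof. by move=> hr; rewrite mxtrace_cols; apply: sumr_ge0. Qed.

Lemma psd_trace_le m n (rho : 'M[C]_m) (Z : 'M[C]_(m, n)) :
  psd rho -> \tr (rho *m (Z *m Z^H)) <= \tr rho * \tr (Z *m Z^H).
Proof.
move=> hr; rewrite mxtrace_cols -[Z *m _ in leRHS]mul1mx mxtrace_cols.
rewrite mulr_sumr; apply: ler_sum => j _; rewrite mulmx1 -norm2E.
exact: psd_le_trace.
Qed.

(** The variance tr(rho (Y - f)^2) with f = tr(rho Y) is nonnegative, so f^2 <= tr(rho Y^2); this is
    applied to X, X^2, X^4 and so on. At the end [rho] is dropped by [psd_trace_le], as X^(2^k) with
    k > 0 has the form Z Z^H. *)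
Lemma trace_pow2_bound n (rho X : 'M[C]_n) k :
  psd rho -> rho^H = rho -> \tr rho = 1 -> X^H = X -> (0 < k)%N ->
  `|\tr (rho *m X)| ^+ (2 ^ k) <= \tr (X ^+ (2 ^ k)).
Proof.
move=> hr hh ht hX.
have sq (Y : 'M[C]_n) : Y^H = Y -> Y ^+ 2 = Y *m Y^H by move=> ->.
have step (Y : 'M[C]_n) : Y^H = Y ->
    `|\tr (rho *m Y)| ^+ 2 <= \tr (rho *m Y ^+ 2).
  move=> hY; set f := \tr (rho *m Y).
  have fr : f^* = f by rewrite -mxtrace_adj adjM hY hh mxtrace_mulC.
  have := psd_trace_ge0 (Y - f%:M) hr.
  have -> : (Y - f%:M)^H = Y - f%:M.
    by rewrite adjB hY adj_scalar fr.
  rewrite mulmxBl !mulmxBr !mul_scalar_mx !mul_mx_scalar -!scalemxAr.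
  rewrite mul_mx_scalar !raddfB /= !mxtraceZ ht mulr1 -/f subrr addr0.
  by rewrite subr_ge0 normCK fr.
case: k => // k _.
have main : `|\tr (rho *m X)| ^+ (2 ^ k.+1) <= \tr (rho *m X ^+ (2 ^ k.+1)).
  elim: k => [|i IH]; first exact: step.
  rewrite expnSr !exprM; apply: le_trans (step _ (adjX _ hX)).
  have ge0 : 0 <= \tr (rho *m X ^+ (2 ^ i.+1)).
    by apply: le_trans IH; rewrite exprn_ge0.
  by rewrite (ger0_norm ge0); apply: lerXn2r; rewrite ?nnegrE ?exprn_ge0.
apply: le_trans main _.
have := psd_trace_le (X ^+ (2 ^ k)) hr.
by rewrite ht mul1r -sq ?adjX // expnSr exprM.
Qed.

Lemma norm2_adj_mul m n (A : 'M[C]_(m, n)) v :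
  norm2 (A *m v) = (v^H *m (A^H *m A) *m v) 0 0.
Proof. by rewrite norm2E adjM !mulmxA. Qed.

(** Lagrange's identity: twice the difference of the two sides is the sum of all |x i - x j|^2. *)
Lemma sqr_norm_sum (I : finType) (x : I -> C) :
  `|\sum_i x i| ^+ 2 <= #|I|%:R * \sum_i `|x i| ^+ 2.
Proof.
rewrite -subr_ge0 -(@pmulrn_lge0 _ _ 2) //.
have -> : (#|I|%:R * (\sum_i `|x i| ^+ 2) - `|\sum_i x i| ^+ 2) *+ 2 =
   \sum_i \sum_j `|x i - x j| ^+ 2.
  have E i j : `|x i - x j| ^+ 2 =
      `|x i| ^+ 2 + `|x j| ^+ 2 - x i * (x j)^* - (x i)^* * x j.
    by rewrite !normCK rmorphB /=; ring.
  set S := \sum_i `|x i| ^+ 2; set s := \sum_i x i.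
  have E1 i : \sum_j `|x i - x j| ^+ 2 =
      #|I|%:R * `|x i| ^+ 2 + S - x i * s^* - (x i)^* * s.
    under eq_bigr do rewrite E.
    by rewrite !big_split /= !sumrN sumr_const -!mulr_sumr mulr_natl rmorph_sum.
  under [RHS]eq_bigr do rewrite E1.
  rewrite !big_split /= !sumrN -!mulr_suml -!mulr_sumr sumr_const -/S -/s.
  rewrite -rmorph_sum /= -/s normCK -(mulr_natl S).
  by move: (#|I|%:R : C) => N; ring.
by apply: sumr_ge0 => i _; apply: sumr_ge0 => j _; rewrite exprn_ge0.
Qed.

Lemma norm2_sum n (I : finType) (u : I -> 'cV[C]_n) :
  norm2 (\sum_i u i) <= #|I|%:R * \sum_i norm2 (u i).
Proof.
rewrite exchange_big mulr_sumr; apply: ler_sum => k _; rewrite summxE.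
exact: sqr_norm_sum.
Qed.

Lemma norm2B n (u v : 'cV[C]_n) : norm2 (u - v) <= 2 * (norm2 u + norm2 v).
Proof.
have := @norm2_sum _ bool (fun b => if b then u else - v).
rewrite !big_bool card_bool /=; congr (_ <= _ * (_ + _)).
by apply: eq_bigr => i _; rewrite mxE normrN.
Qed.

Lemma norm2Z n a (u : 'cV[C]_n) : norm2 (a *: u) = `|a| ^+ 2 * norm2 u.
Proof. by rewrite mulr_sumr; apply: eq_bigr => i _; rewrite mxE normrM exprMn. Qed.

Definition bounded_by b m n (A : 'M[C]_(m, n)) : Prop :=
  forall v : 'cV[C]_n, norm2 (A *m v) <= b ^+ 2 * norm2 v.

Lemma bounded_by1 n : bounded_by 1 (1%:M : 'M_n).
Proof. by move=> v; rewrite mul1mx expr1n mul1r. Qed.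

Lemma bounded_byM a b m n p (A : 'M_(m, n)) (B : 'M_(n, p)) :
  0 <= a -> bounded_by a A -> bounded_by b B -> bounded_by (a * b) (A *m B).
Proof.
move=> a0 hA hB v; rewrite -mulmxA; apply: le_trans (hA _) _.
by rewrite exprMn -[leRHS]mulrA ler_wpM2l ?exprn_ge0.
Qed.

Lemma bounded_by_prod b n (I : Type) (r : seq I) (X : I -> 'M_n) :
  0 <= b -> (forall i, bounded_by b (X i)) ->
  bounded_by (b ^+ size r) (\prod_(i <- r) X i).
Proof.
move=> b0 hX; elim: r => [|i r IH]; first by rewrite big_nil expr0; apply: bounded_by1.
by rewrite big_cons exprS; apply: bounded_byM.
Qed.

(** Each diagonal entry is a coordinate of the image of a unit vector, so its modulus is at most
    [b]. *)
Lemma bounded_by_trace b n (A : 'M_n) :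
  0 <= b -> bounded_by b A -> `|\tr A| <= n%:R * b.
Proof.
move=> b0 hA; apply: le_trans (ler_norm_sum _ _ _) _.
rewrite -[n in leRHS]card_ord -sum1_card natr_sum mulr_suml.
apply: ler_sum => i _; rewrite mul1r -(@ler_pXn2r _ 2) ?nnegrE //.
have := hA (delta_mx i 0); rewrite -colE.
have -> : norm2 (delta_mx i 0 : 'cV[C]_n) = 1.
  rewrite /norm2 (bigD1 i) //= mxE !eqxx normr1 expr1n big1 ?addr0 // => j ji.
  by rewrite mxE (negPf ji) normr0 expr0n.
rewrite mulr1; apply: le_trans; rewrite /norm2 (bigD1 i) //= mxE ler_wpDr //.
by apply: sumr_ge0 => j _; rewrite exprn_ge0.
Qed.

Lemma isometry_bounded m n (V : 'M[C]_(m, n)) :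
  V^H *m V = 1%:M -> bounded_by 1 V.
Proof.
by move=> hV v; rewrite norm2_adj_mul hV mulmx1 -norm2E expr1n mul1r.
Qed.

(** [V *m V^H] is an orthogonal projection, so by Pythagoras the defect [norm2 v - norm2 (V^H *m v)]
    is itself the [norm2] of a vector. *)
Lemma coisometry_bounded m n (V : 'M[C]_(m, n)) :
  V^H *m V = 1%:M -> bounded_by 1 V^H.
Proof.
move=> hV v; rewrite expr1n mul1r -subr_ge0.
suff <- : norm2 (v - V *m (V^H *m v)) = norm2 v - norm2 (V^H *m v).
  exact: norm2_ge0.
rewrite !norm2E adjB !adjM adjK !mulmxBl !mulmxBr -!mulmxA.
rewrite [V^H *m (V *m _)]mulmxA hV mul1mx.
by rewrite subrr subr0 !mxE.
Qed.

Definition center (Y : finType) n (M : Y -> 'M[C]_n) y : 'M[C]_n :=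
  M y - #|Y|%:R^-1 *: \sum_z M z.

Lemma center_sum (Y : finType) n (M : Y -> 'M[C]_n) (y0 : Y) :
  \sum_y center M y = 0.
Proof.
have Y0 : #|Y|%:R != 0 :> C by rewrite pnatr_eq0 -lt0n; apply/card_gt0P; exists y0.
by rewrite sumrB sumr_const -scaler_nat scalerA mulfV // scale1r subrr.
Qed.

Lemma center_adj (Y : finType) n (M : Y -> 'M[C]_n) y :
  (forall z, (M z)^H = M z) -> (center M y)^H = center M y.
Proof.
move=> hM; rewrite adjB adjZ hM geC0_conj ?invr_ge0 ?ler0n //; congr (_ - _ *: _).
by rewrite adj_sum; apply: eq_bigr => z _; rewrite hM.
Qed.

(** The mean of contractions is a contraction by convexity, and [norm2B] then gives 2 * (1 + 1) = 2
    ^ 2. *)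
Lemma center_bounded (Y : finType) n (M : Y -> 'M[C]_n) y :
  (forall z, bounded_by 1 (M z)) -> bounded_by 2 (center M y).
Proof.
move=> hM v.
have Y0 : 0 < #|Y|%:R :> C by rewrite ltr0n; apply/card_gt0P; exists y.
have h1 z : norm2 (M z *m v) <= norm2 v.
  by have := hM z v; rewrite expr1n mul1r.
rewrite mulmxBl; apply: le_trans (norm2B _ _) _.
rewrite expr2 -mulrA ler_wpM2l // mulr_natl mulr2n lerD //.
rewrite -scalemxAl norm2Z mulmx_suml normfV (ger0_norm (ltW Y0)).
rewrite exprVn ler_pdivrMl ?exprn_gt0 //.
apply: le_trans (norm2_sum _) _.
rewrite expr2 -[leRHS]mulrA ler_pM2l // mulr_natl -sumr_const.
by apply: ler_sum => z _; apply: h1.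
Qed.

End HermitianMatrices.

(** * Moments of sums of independent centered matrices *)

Section MomentBound.

Definition upd (I Y : finType) (y : {ffun I -> Y}) t z : {ffun I -> Y} :=
  [ffun i => if i == t then z else y i].

(** The functions split into classes that agree off [t], each represented by its member with value
    [z0] at [t]; every class sums to 0. *)
Lemma sum_resample (I Y : finType) (V : zmodType) (t : I) (F : {ffun I -> Y} -> V) :
  (forall y, \sum_z F (upd y t z) = 0) -> \sum_y F y = 0.
Proof.
move=> hF; case: (pickP (@predT Y)) => [z0 _|noY]; last first.
  by apply: big1 => y; have := noY (y t).
rewrite (partition_big (fun y => upd y t z0) predT) //=; apply: big1 => y' _.
have [y't|y't] := eqVneq (y' t) z0; last first.
  rewrite big_pred0 // => y; apply/eqP => /ffunP /(_ t); rewrite ffunE eqxx => e.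
  by rewrite e eqxx in y't.
rewrite (reindex_onto (upd y' t) (fun y => y t)) /=; last first.
  move=> y /eqP <-; apply/ffunP => i; rewrite !ffunE.
  by case: eqP => // ->.
rewrite -[RHS](hF y'); apply: eq_bigl => z; rewrite ffunE eqxx eqxx andbT.
apply/eqP/ffunP => i; rewrite !ffunE; by case: eqP => // ->.
Qed.

Definition no_singleton q T (w : {ffun 'I_q -> 'I_T}) : bool :=
  [forall t, #|[set j | w j == t]| != 1%N].

(** Each letter of such a word uses up at least two positions, so at most [p] letters occur. The
    word is thus a list of [p] letters together with a map from positions to list indices, which
    [glue] recombines. *)
Lemma card_no_singleton p T : (0 < p)%N ->
  (#|[set w : {ffun 'I_(p.*2) -> 'I_T} | no_singleton w]| <= T ^ p * p ^ p.*2)%N.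
Proof.
move=> p0.
pose glue (gh : {ffun 'I_p -> 'I_T} * {ffun 'I_(p.*2) -> 'I_p}) :
  {ffun 'I_(p.*2) -> 'I_T} := [ffun j => gh.1 (gh.2 j)].
have -> : (T ^ p * p ^ p.*2)%N =
    #|{: {ffun 'I_p -> 'I_T} * {ffun 'I_(p.*2) -> 'I_p}}|.
  by rewrite card_prod !card_ffun !card_ord.
rewrite -cardsT; apply: leq_trans (leq_imset_card glue _).
apply/subset_leq_card/subsetP => w; rewrite inE => /forallP hw.
set A := w @: [set: 'I_(p.*2)].
have A2 : (#|A|.*2 <= p.*2)%N.
  rewrite -[p.*2 in leqRHS]card_ord -cardsT.
  rewrite -[leqRHS]sum1_card (partition_big_imset w) /= -/A.
  rewrite -muln2 -sum_nat_const; apply: leq_sum => t tA.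
  have := hw t; rewrite sum1_card.
  have -> : #|[pred i in [set: 'I_(p.*2)] | w i == t]| = #|[set j | w j == t]|.
    by apply: eq_card => j; rewrite !inE.
  have : (0 < #|[set j | w j == t]|)%N.
    by apply/card_gt0P; case/imsetP: tA => j _ ->; exists j; rewrite inE.
  by case: #|_| => [|[|]].
have Ap : (#|A| <= p)%N by rewrite -leq_double.
have pp : (0 < p.*2)%N by rewrite double_gt0.
(* Default letter that pads the list when fewer than [p] letters occur. *)
pose t0 := w (Ordinal pp).
have hi j : (index (w j) (enum A) < p)%N.
  by apply: leq_trans Ap; rewrite cardE index_mem mem_enum imset_f.
apply/imsetP; exists ([ffun i : 'I_p => nth t0 (enum A) i],
    [ffun j => Ordinal (hi j)]); first by rewrite inE.
apply/ffunP => j; rewrite !ffunE /= nth_index // mem_enum; exact: imset_f.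
Qed.

Variable C : numClosedFieldType.

(** If [t] occurs only at position [j0], the product is linear in [X (y t)], so summing over the
    coordinate [t] alone already gives 0. *)
Lemma word_vanish q T n (Y : finType) (X : Y -> 'M[C]_n) (w : {ffun 'I_q -> 'I_T}) :
  \sum_z X z = 0 -> ~~ no_singleton w ->
  \sum_(y : {ffun 'I_T -> Y}) \prod_j X (y (w j)) = 0.
Proof.
move=> X0 /forallPn [t]; rewrite negbK => /cards1P [j0 hj0].
apply: (@sum_resample _ _ _ t) => y.
have hw j : (w j == t) = (j == j0).
  by have /setP/(_ j) := hj0; rewrite !inE.
have wj0 : w j0 = t by apply/eqP; rewrite hw.
(* The factors need not commute, so the product is split into the positions before and after
   [j0]. *)
case/splitPr E : _ / (mem_index_enum j0) => [s1 s2].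
have := index_enum_uniq 'I_q; rewrite E cat_uniq /= => /and3P [_ h1 /andP[h2 _]].
rewrite negb_or in h1; case/andP: h1 => h1 _.
have split z : \prod_(j <- s1 ++ j0 :: s2) X (upd y t z (w j)) =
   (\prod_(j <- s1) X (y (w j))) * (X z * \prod_(j <- s2) X (y (w j))).
  rewrite big_cat big_cons /= ffunE wj0 eqxx; congr (_ * (_ * _)).
    apply: eq_big_seq => j js; rewrite ffunE hw; case: eqP => // e.
    by rewrite -e js in h1.
  apply: eq_big_seq => j js; rewrite ffunE hw; case: eqP => // e.
  by rewrite -e js in h2.
under eq_bigr do rewrite split.
by rewrite -mulr_sumr -mulr_suml X0 mul0r mulr0.
Qed.

(** The power expands into words of length [p.*2], and only words without a singleton survive. For
    each of the #|Y| ^ T samples, the product along a word is bounded by [b ^+ p.*2], hence has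
    trace at most [n] times that. *)
Lemma moment_bound p T n b (Y : finType) (X : Y -> 'M[C]_n) :
  (0 < p)%N -> 0 <= b -> \sum_z X z = 0 -> (forall z, bounded_by b (X z)) ->
  `|\sum_(y : {ffun 'I_T -> Y}) \tr ((\sum_i X (y i)) ^+ p.*2)| <=
    (T ^ p * p ^ p.*2 * (#|Y| ^ T * n))%:R * b ^+ p.*2.
Proof.
move=> p0 b0 X0 hb.
have -> : \sum_(y : {ffun 'I_T -> Y}) \tr ((\sum_i X (y i)) ^+ p.*2) =
   \sum_(w : {ffun 'I_(p.*2) -> 'I_T})
     \tr (\sum_(y : {ffun 'I_T -> Y}) \prod_j X (y (w j))).
  under [RHS]eq_bigr do rewrite raddf_sum /=.
  rewrite [RHS]exchange_big /=. apply: eq_bigr => y _.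
  rewrite -raddf_sum; congr (\tr _).
  rewrite -(bigA_distr_bigA (fun (j : 'I_(p.*2)) i => X (y i))).
  by rewrite prodr_const card_ord.
rewrite (bigID (@no_singleton _ _)) /= [X in _ + X]big1 ?addr0; last first.
  by move=> w hw; rewrite word_vanish // mxtrace0.
apply: le_trans (ler_norm_sum _ _ _) _.
apply: (@le_trans _ _ (\sum_(w : {ffun 'I_(p.*2) -> 'I_T} | no_singleton w)
    (#|Y| ^ T * n)%:R * b ^+ p.*2)).
  apply: ler_sum => w _; rewrite raddf_sum /=.
  apply: le_trans (ler_norm_sum _ _ _) _.
  rewrite natrM -mulrA mulr_natl -[X in _ *+ X]/(#|Y| ^ T)%N -[T in (_ ^ T)%N]card_ord.
  rewrite -card_ffun -sumr_const; apply: ler_sum => y _.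
  apply: bounded_by_trace; first exact: exprn_ge0.
  have := @bounded_by_prod C b n _ (index_enum 'I_(p.*2)) (fun j => X (y (w j))) b0.
  rewrite [size _](_ : _ = p.*2); first by apply=> j.
  by rewrite -[RHS]card_ord cardT enumT.
rewrite sumr_const -[leLHS]mulr_natl mulrA ler_wpM2r ?exprn_ge0 //.
rewrite -natrM ler_nat leq_mul2r; apply/orP; right.
apply: leq_trans (card_no_singleton T p0); rewrite leq_eqVlt; apply/orP; left.
by apply/eqP/eq_card => w; rewrite !inE.
Qed.

End MomentBound.

(** * Quantum circuits as contractions *)

Section Circuits.
Variable R : realType.
Local Notation C := R[i].

Lemma sqrt2_sqr : sqrt2 R * sqrt2 R = 2.
Proof.
by rewrite /sqrt2 -rmorphM /= -expr2 sqr_sqrtr ?ler0n // rmorph_nat.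
Qed.

Lemma sqrt2_conj : (sqrt2 R)^* = sqrt2 R.
Proof. exact: conjc_real. Qed.

Lemma sum_enum_val n (F : bits n -> C) :
  \sum_(k < qdim n) F (enum_val k) = \sum_x F x.
Proof. by rewrite [RHS](reindex _ (onW_bij _ (@enum_val_bij _))). Qed.

Definition mx_of2 m n (f : bits m -> bits n -> C) : 'M[C]_(qdim m, qdim n) :=
  \matrix_(i, j) f (enum_val i) (enum_val j).

Lemma mx_of2_isometry m n (f : bits m -> bits n -> C) :
  (forall x y, \sum_z (f z x)^* * f z y = (x == y)%:R) ->
  (mx_of2 f)^H *m mx_of2 f = 1%:M.
Proof.
move=> hf; apply/matrixP => i j; rewrite !mxE.
under eq_bigr do rewrite !mxE.
by rewrite (sum_enum_val (fun z => (f z _)^* * f z _)) hf (inj_eq enum_val_inj).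
Qed.

Lemma graph_isometry m n (N : bits n -> bits m) :
  injective N ->
  (mx_of2 (fun x y => (x == N y)%:R))^H *m mx_of2 (fun x y => (x == N y)%:R) = 1%:M.
Proof.
move=> injN; apply: mx_of2_isometry => x y.
rewrite (bigD1 (N x)) //= eqxx conjC1 mul1r (inj_eq injN) big1 ?addr0 //.
by move=> z /negPf ->; rewrite conjC0 mul0r.
Qed.

Lemma sum_agree_except w (i : 'I_w) (x : bits w) (F : bits w -> C) :
  \sum_(z | agree_except i z x) F z = \sum_b F (upd x i b).
Proof.
rewrite (reindex_onto (upd x i) (fun z => z i)) /=.
  apply: eq_bigl => b; rewrite ffunE !eqxx andbT.
  by apply/forallP => j; apply/implyP => ji; rewrite ffunE (negPf ji).
move=> z /forallP hz; apply/ffunP => j; rewrite ffunE; case: eqP => [->//|/eqP ji].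
by have := hz j; rewrite ji => /eqP.
Qed.

Lemma agree_except_upd w (i : 'I_w) (x y : bits w) b :
  agree_except i (upd x i b) y = agree_except i x y.
Proof.
apply: eq_forallb => j; rewrite ffunE; by case: eqP.
Qed.

Lemma agree_except_updr w (i : 'I_w) (x y : bits w) b :
  agree_except i x (upd y i b) = agree_except i x y.
Proof. by apply: eq_forallb => j; rewrite ffunE; case: eqP. Qed.

Lemma eq_agree_except w (i : 'I_w) (x y : bits w) :
  (x == y) = agree_except i x y && (x i == y i).
Proof.
apply/eqP/andP => [->|[/forallP h /eqP e]].
  by split=> //; apply/forallP => j; rewrite eqxx implybT.
apply/ffunP => j; have [->//|ji] := eqVneq j i.
by have := h j; rewrite ji => /eqP.
Qed.

Lemma gate_unitary w (g : gate w) :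
  gate_wf g -> (gate_mx R g)^H *m gate_mx R g = 1%:M.
Proof.
case: g => [i _|i _|c t /= ct].
- rewrite /gate_mx; apply: mx_of2_isometry => x y.
  pose sg (b : bool) : C := if b then -1 else 1.
  have -> : \sum_z (if agree_except i z x then sg (z i && x i) / sqrt2 R else 0)^* *
      (if agree_except i z y then sg (z i && y i) / sqrt2 R else 0) =
    \sum_(z | agree_except i z x) (sg (z i && x i) / sqrt2 R)^* *
      (if agree_except i z y then sg (z i && y i) / sqrt2 R else 0).
    rewrite [RHS]big_mkcond; apply: eq_bigr => z _.
    by case: ifP => // _; rewrite conjC0 mul0r.
  (* Only two strings agree with [x] off wire [i], so the inner product of two columns has two
     terms. *)
  rewrite sum_agree_except big_bool !agree_except_upd !ffunE !eqxx /=.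
  rewrite (eq_agree_except i x y).
  case: (agree_except i x y); last by rewrite !mulr0 addr0.
  rewrite /= !rmorphM !fmorphV /= !sqrt2_conj /sg.
  have s2 : (sqrt2 R)^-1 * (sqrt2 R)^-1 = 2^-1 by rewrite -invfM sqrt2_sqr.
  by case: (x i); case: (y i); rewrite ?conjC1 ?rmorphN1 /= ?rmorph1 ?mulN1r
    ?mul1r ?mulNr ?mulrN ?opprK s2; field.
- rewrite /gate_mx; apply: mx_of2_isometry => x y.
  rewrite (bigD1 x) //= eqxx big1 ?addr0 => [|z /negPf ->]; last by rewrite conjC0 mul0r.
  case: eqP => _; last by rewrite mulr0.
  case: ifP => _; last by rewrite conjC1 mulr1.
  rewrite rmorphM fmorphV /= sqrt2_conj rmorphD rmorph1 complexiE.
  rewrite [X in (1 + X) / _]conjCi.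
  rewrite mulrACA -invfM sqrt2_sqr (_ : (1 - 'i) * (1 + 'i) = 2) ?divff ?pnatr_eq0 //.
  by rewrite -subr_sqr sqrCi expr1n opprK.
(* CNOT permutes the basis by the involution [N]; since control and target differ, the control bit
   is unchanged. *)
pose N (y : bits w) := upd y t (y t (+) y c).
have NK : involutive N.
  move=> y; apply/ffunP => j; rewrite !ffunE eqxx (negPf ct).
  by case: eqP => // ->; rewrite addbK.
rewrite (_ : mx_of _ = mx_of2 (fun x y => (x == N y)%:R)).
  exact: graph_isometry (inv_inj NK).
apply/matrixP => i j; rewrite !mxE (eq_agree_except t) agree_except_updr ffunE eqxx.
by case: (_ && _).
Qed.

Lemma circ_unitary w (gs : seq (gate w)) :
  all (@gate_wf _) gs -> (circ_mx R gs)^H *m circ_mx R gs = 1%:M.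
Proof.
(* For the induction, the accumulator of [foldl] is generalized to any isometry [U]. *)
rewrite /circ_mx; set U := (X in foldl _ X); have : U^H *m U = 1%:M.
  by rewrite mulmx1 map_mx1 trmx1.
elim: gs U => [|g gs IH] U hU //= /andP [hg hgs]; apply: IH => //.
by rewrite adjM -mulmxA [X in _ *m X]mulmxA gate_unitary // mul1mx.
Qed.

(** The basis string of |z>|y>|0^m>; the ancilla wires get [false]. *)
Definition join_parts a n m (y : bits n) (z : bits a) : bits (a + (n + m)) :=
  [ffun k => match split k with
    | inl i => z i
    | inr k' => if split k' is inl i then y i else false
    end].

Lemma eq_join_parts a n m (y : bits n) (z : bits a) (x : bits (a + (n + m))) :
  (x == join_parts m y z) =
  [&& adv_part x == z, inp_part x == y & anc_part x == [ffun=> false]].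
Proof.
apply/eqP/and3P => [->|[/eqP <- /eqP <- /eqP h]].
  split; apply/eqP/ffunP => i; rewrite !ffunE.
  - by rewrite (unsplitK (inl i)).
  - by rewrite (unsplitK (inr _)) (unsplitK (inl i)).
  by rewrite (unsplitK (inr _)) (unsplitK (inr i)).
apply/ffunP => k; rewrite ffunE; case: splitP => [i|k'] e.
  by rewrite ffunE; congr (x _); apply: val_inj.
case: splitP => [i|i] e'.
  by rewrite ffunE; congr (x _); apply: val_inj; rewrite /= e e'.
have := congr1 (fun f : bits m => f i) h; rewrite !ffunE => <-.
by congr (x _); apply: val_inj; rewrite /= e e'.
Qed.

Lemma join_parts_inj a n m (y : bits n) : injective (@join_parts a n m y).
Proof.
have adv_join (z : bits a) : adv_part (join_parts m y z) = z.
  by have := eqxx (join_parts m y z); rewrite {1}eq_join_parts => /and3P[/eqP].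
by move=> z z' e; rewrite -(adv_join z) e adv_join.
Qed.

Definition input_mx a n m (y : bits n) : 'M[C]_(qdim (a + (n + m)), qdim a) :=
  mx_of2 (fun x z => (x == join_parts m y z)%:R).

Lemma input_isometry a n m (y : bits n) :
  (input_mx a m y)^H *m input_mx a m y = 1%:M.
Proof. exact: graph_isometry (@join_parts_inj _ _ _ _). Qed.

(** As a conjugate of [rho] by an isometry, the initial state lets the whole experiment be pulled
    back to the advice register. *)
Lemma init_stateE a n m (rho : qop R a) (y : bits n) :
  init_state m rho y = input_mx a m y *m rho *m (input_mx a m y)^H.
Proof.
apply/matrixP => i j; rewrite !mxE.
have hV (x : bits (a + (n + m))) z : (x == join_parts m y z)%:R =
    (enum_rank (adv_part x) == enum_rank z)%:R *
    ((inp_part x == y) && (anc_part x == [ffun=> false]))%:R :> C.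
  by rewrite eq_join_parts (inj_eq enum_rank_inj) -natrM mulnb.
rewrite (bigD1 (enum_rank (adv_part (enum_val j)))) //= big1 ?addr0; last first.
  by move=> k hk; rewrite !mxE hV enum_valK eq_sym (negPf hk) mul0r conjC0 mulr0.
rewrite !mxE hV !enum_rankK eqxx mul1r.
rewrite (bigD1 (enum_rank (adv_part (enum_val i)))) //= big1 ?addr0; last first.
  by move=> k hk; rewrite !mxE hV enum_valK eq_sym (negPf hk) !mul0r.
rewrite !mxE hV !enum_rankK eqxx mul1r conjC_nat /entry.
rewrite mulrAC -natrM mulnb [LHS]mulrC.
by congr ((nat_of_bool _)%:R * _); do ![case: (_ == _)].
Qed.

(** The projector onto outcome 1 of wire [o]. *)
Definition out_mx w (o : 'I_w) : qop R w :=
  \matrix_(i, j) ((i == j) && (enum_val i : bits w) o)%:R.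

Lemma out_mx_adj w (o : 'I_w) : (out_mx o)^H = out_mx o.
Proof.
apply/matrixP => i j; rewrite !mxE conjC_nat eq_sym.
by case: eqP => // ->.
Qed.

Lemma out_mx_mulE w (o : 'I_w) n (A : 'M[C]_(_, n)) i j :
  (out_mx o *m A) i j = ((enum_val i : bits w) o)%:R * A i j.
Proof.
rewrite mxE (bigD1 i) //= big1 ?addr0 => [|k hk]; first by rewrite mxE eqxx.
by rewrite mxE eq_sym (negPf hk) mul0r.
Qed.

Lemma out_mx_bounded w (o : 'I_w) : bounded_by 1 (out_mx o).
Proof.
move=> v; rewrite expr1n mul1r; apply: ler_sum => i _; rewrite out_mx_mulE.
by case: (_ o); rewrite ?mul1r // mul0r normr0 expr0n exprn_ge0.
Qed.

(* The effect of the measurement, pulled back to the advice register. *)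
Definition accept_mx a n m (gs : seq (gate (a + (n + m)))) o (y : bits n) : qop R a :=
  let B := circ_mx R gs *m input_mx a m y in B^H *m out_mx o *m B.

Lemma accept_mx_adj a n m (gs : seq (gate (a + (n + m)))) o y :
  (accept_mx gs o y)^H = accept_mx gs o y.
Proof. by rewrite /accept_mx !(adjM, adjK) out_mx_adj !mulmxA. Qed.

Lemma accept_mx_bounded a n m (gs : seq (gate (a + (n + m)))) o y :
  all (@gate_wf _) gs -> bounded_by 1 (accept_mx gs o y).
Proof.
move=> hgs; have hV := input_isometry a m y; have hU := circ_unitary hgs.
rewrite /accept_mx adjM -[1]mulr1; apply: bounded_byM => //; last first.
  rewrite -[1]mulr1; apply: bounded_byM => //; exact: isometry_bounded.
rewrite -[1]mulr1; apply: bounded_byM => //; last exact: out_mx_bounded.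
rewrite -[1]mulr1; apply: bounded_byM => //; exact: coisometry_bounded.
Qed.

(** Cyclicity of the trace moves the circuit and the input isometry onto the projector. The real
    part in [accept_prob] loses nothing, because [rho] and the effect are both Hermitian. *)
Lemma accept_probE n (A : qalg R n) y : density_matrix (qa_rho A) ->
  (accept_prob A y)%:C%C = \tr (qa_rho A *m accept_mx (qa_gates A) (qa_out A) y).
Proof.
case: A => a m gs o rho /= [hh _]; rewrite /accept_prob /=.
set U := circ_mx R gs; set V := input_mx a m y.
have e : \tr (rho *m accept_mx gs o y) =
    \sum_(x : bits _ | x o) entry (U *m init_state m rho y *m adjoint U) x x.
  rewrite init_stateE /accept_mx -/U -/V.
  have -> : \sum_(x : bits _ | x o) entry (U *m (V *m rho *m V^H) *m adjoint U) x x
      = \tr (out_mx o *m ((U *m V) *m rho *m (U *m V)^H)).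
    rewrite big_mkcond /= -(sum_enum_val (fun x => if x o then _ else _)).
    apply: eq_bigr => i _; rewrite out_mx_mulE /entry enum_valK adjM !mulmxA.
    by case: (_ o); rewrite ?mul1r ?mul0r.
  move: (U *m V) => B.
  by rewrite -(mulmxA B^H) (mulmxA rho) mxtrace_mulC !mulmxA.
rewrite e; apply: RRe_real; apply/CrealP.
by rewrite -e -mxtrace_adj adjM accept_mx_adj (hh : rho^H = rho) mxtrace_mulC.
Qed.

End Circuits.

(** * Encoding circuits in a finite type *)

Lemma card_tagged_ord_leq k (T : 'I_k -> finType) B :
  (forall i, #|T i| <= B)%N -> (#|{: {i : 'I_k & T i}}| <= k * B)%N.
Proof.
move=> hB; rewrite card_tagged sumnE big_map big_enum /= -[k in leqRHS]card_ord.
by rewrite -sum_nat_const leq_sum.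
Qed.

Section CircuitCodes.

Definition gate_code w : finType := ('I_w + 'I_w + 'I_w * 'I_w)%type.

Definition gate_of_code w (g : gate_code w) : gate w :=
  match g with
  | inl (inl i) => GH i
  | inl (inr i) => GT i
  | inr (c, t) => GCNOT c t
  end.

Definition code_of_gate w (g : gate w) : gate_code w :=
  match g with
  | GH i => inl (inl i)
  | GT i => inl (inr i)
  | GCNOT c t => inr (c, t)
  end.

Lemma code_of_gateK w : cancel (@code_of_gate w) (@gate_of_code w).
Proof. by case. Qed.

(** [None] pads circuits with fewer than [s] gates, and the filter drops CNOTs with equal wires, so
    every code decodes to a well-formed circuit. *)
Definition gates_of_code w s (t : s.-tuple (option (gate_code w))) : seq (gate w) :=
  [seq g <- map (@gate_of_code w) (pmap id t) | gate_wf g].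

Lemma gates_of_code_wf w s (t : s.-tuple (option (gate_code w))) :
  all (@gate_wf w) (gates_of_code t).
Proof. exact: filter_all. Qed.

Lemma gates_of_code_surj w s (gs : seq (gate w)) :
  all (@gate_wf w) gs -> (size gs <= s)%N ->
  exists t : s.-tuple (option (gate_code w)), gates_of_code t = gs.
Proof.
move=> hgs hs.
pose l := map (fun g => Some (code_of_gate g)) gs ++ nseq (s - size gs) None.
have sl : size l == s by rewrite size_cat size_map size_nseq subnKC.
exists (Tuple sl); rewrite /gates_of_code /= /l pmap_cat.
have -> : pmap id (nseq (s - size gs) (@None (gate_code w))) = [::].
  by elim: (_ - _)%N.
rewrite cats0; have -> : pmap id [seq Some (code_of_gate g) | g <- gs] = map (@code_of_gate w) gs.
  by elim: gs {hgs hs l sl} => //= g gs ->.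
by rewrite (mapK (@code_of_gateK w)); apply/all_filterP.
Qed.

Definition output_gates_code w s : finType :=
  ('I_w * s.-tuple (option (gate_code w)))%type.

(** The advice state is left out and only the sizes of the advice and ancilla registers are kept, so
    the type is finite and a union bound applies. *)
Definition circuit_code n s : finType :=
  {a : 'I_s.+1 & {m : 'I_s.+1 & output_gates_code (a + (n + m)) s}}.

(** There are at most W = n + 2s wires. On w wires a gate code or [None] has (w + 1)^2 values, which
    gives the exponent 2s; the two register sizes and the output wire give three more factors. *)
Lemma card_circuit_code n s :
  (#|circuit_code n s| <= (n + s.*2).+1 ^ (s.*2 + 3))%N.
Proof.
set W := (n + s.*2)%N.
apply: (@leq_trans (s.+1 * (s.+1 * (W * (W.+1 ^ 2) ^ s)))).
  apply: card_tagged_ord_leq => a.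
  apply: card_tagged_ord_leq => m.
  have hw : (a + (n + m) <= W)%N.
    rewrite /W addnCA leq_add2l -addnn leq_add // -ltnS; exact: ltn_ord.
  rewrite /output_gates_code card_prod card_ord card_tuple card_option.
  rewrite card_sum card_sum card_prod !card_ord.
  move: (a + (n + m))%N hw => w hw; apply: leq_mul => //.
  have [->//|s0] := posnP s; rewrite leq_exp2r //.
  apply: leq_trans (_ : w.+1 ^ 2 <= _)%N; last by rewrite leq_exp2r.
  by lia.
have sW : (s < W.+1)%N by rewrite ltnS /W -addnn addnA leq_addl.
by rewrite -expnM mul2n addn3 3!expnS !leq_mul // ltnW.
Qed.

End CircuitCodes.

(** * Sampling *)

Section Sampling.
Variable R : realType.
Local Notation C := R[i].

Lemma adj_sum_center (Y I : finType) n (M : Y -> 'M[C]_n) (ys : I -> Y) :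
  (forall z, (M z)^H = M z) ->
  (\sum_i center M (ys i))^H = \sum_i center M (ys i).
Proof. by move=> hM; rewrite adj_sum; apply: eq_bigr => i _; apply: center_adj. Qed.

Lemma trace_even_ge0 n (X : 'M[C]_n) p : X^H = X -> 0 <= \tr (X ^+ p.*2).
Proof.
move=> hX; have -> : X ^+ p.*2 = 1%:M *m (X ^+ p *m (X ^+ p)^H).
  by rewrite mul1mx adjX // mulmxE -exprD addnn.
by apply: psd_trace_ge0 => v; rewrite mulmx1 -norm2E norm2_ge0.
Qed.

(** First moment method: averaged over all samples, the sum of the moments over [c] is at most the
    bound, so some sample meets it. All moments are nonnegative, so each one separately obeys it
    too. *)
Lemma good_sample (Y K : finType) (d : K -> nat) dmax
    (M : forall c, Y -> 'M[C]_(d c)) p T (y0 : Y) :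
  (0 < p)%N -> (forall c, d c <= dmax)%N ->
  (forall c y, (M c y)^H = M c y) -> (forall c y, bounded_by 1 (M c y)) ->
  exists ys : {ffun 'I_T -> Y}, forall c,
    \tr ((\sum_i center (M c) (ys i)) ^+ p.*2) <=
      (#|K| * (T ^ p * p ^ p.*2 * dmax))%:R * 2 ^+ p.*2.
Proof.
move=> p0 hd hM hb; pose B : C := (#|K| * (T ^ p * p ^ p.*2 * dmax))%:R * 2 ^+ p.*2.
pose F (ys : {ffun 'I_T -> Y}) c := \tr ((\sum_i center (M c) (ys i)) ^+ p.*2).
have F0 ys c : 0 <= F ys c by apply: trace_even_ge0; apply: adj_sum_center.
have S0 ys : 0 <= \sum_c F ys c by apply: sumr_ge0.
have B0 : 0 <= B by rewrite mulr_ge0 ?exprn_ge0 ?ler0n.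
suff /existsP [ys hys] : [exists ys, \sum_c F ys c <= B].
  exists ys => c; rewrite -/B; apply: le_trans hys; rewrite -/(F ys c) (bigD1 c) //= ler_wpDr //.
  exact: sumr_ge0.
apply: contraT => /existsPn hF.
have : \sum_(ys : {ffun 'I_T -> Y}) \sum_c F ys c <= (#|Y| ^ T)%:R * B.
  rewrite exchange_big /= /B natrM -[X in _ * X]mulrA mulrCA [leRHS]mulr_natl.
  rewrite -[leRHS]sumr_const.
  apply: ler_sum => c _.
  have := @moment_bound C p T (d c) 2 Y (center (M c)) p0 (ler0n _ 2)
    (center_sum _ y0) (fun z => center_bounded z (hb c)).
  have Fs : 0 <= \sum_ys F ys c by apply: sumr_ge0.
  rewrite (ger0_norm Fs) => h; apply: le_trans h _.
  rewrite mulrA -natrM ler_wpM2r ?exprn_ge0 ?ler0n // ler_nat.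
  by rewrite mulnCA leq_mul2l leq_mul2l hd !orbT.
apply: contraLR => _; have YB0 : 0 <= (#|Y| ^ T)%:R * B by rewrite mulr_ge0 ?ler0n.
rewrite -real_ltNge ?ger0_real ?sumr_ge0 //.
rewrite [ltLHS]mulr_natl -[X in _ *+ X]/(#|Y| ^ T)%N -[T in (_ ^ T)%N]card_ord -card_ffun.
rewrite -[ltLHS]sumr_const; apply: ltr_sum => [|ys _].
  by apply/hasP; exists [ffun=> y0]; rewrite ?mem_index_enum.
by rewrite real_ltNge ?ger0_real // hF.
Qed.

End Sampling.

(** * The empirical distribution of a sample *)

Section EmpiricalDistribution.
Variable R : realType.
Local Notation C := R[i].
Variables (n T : nat) (ys : {ffun 'I_T -> bits n}).

Definition empirical : {ffun bits n -> R} :=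
  [ffun y => #|[set i | ys i == y]|%:R / T%:R].

Lemma empirical_mean (f : bits n -> R) :
  \sum_y empirical y * f y = T%:R^-1 * \sum_i f (ys i).
Proof.
rewrite (partition_big ys predT) //= mulr_sumr; apply: eq_bigr => y _.
rewrite ffunE (eq_bigr (fun=> f y)) => [|i /eqP -> //].
rewrite sumr_const -(mulr_natl (f y)) mulrCA mulrA; congr (_%:R / _ * _).
by apply: eq_card => i; rewrite !inE.
Qed.

Lemma empirical_distribution : (0 < T)%N -> distribution empirical.
Proof.
move=> T0; split=> [y|]; first by rewrite ffunE divr_ge0 ?ler0n.
under eq_bigr do rewrite -[empirical _]mulr1.
by rewrite empirical_mean sumr_const card_ord mulVf // pnatr_eq0 -lt0n.
Qed.

Lemma card_supp_empirical : (#|supp empirical| <= T)%N.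
Proof.
rewrite -[T in leqRHS]card_ord -cardsT; apply: leq_trans (leq_imset_card ys _).
apply/subset_leq_card/subsetP => y; rewrite !inE ffunE mulf_eq0 negb_or => /andP[+ _].
rewrite pnatr_eq0 -lt0n; case/card_gt0P => i; rewrite inE => /eqP <-.
by rewrite imset_f.
Qed.

(** Puts the advantage in the form tr(rho X) with X free of the advice state; the centering accounts
    for the uniform term. *)
Lemma empirical_advantage (A : qalg R n) : density_matrix (qa_rho A) -> (0 < T)%N ->
  (\sum_y empirical y * accept_prob A y
     - \sum_y accept_prob A y / (2 ^ n)%:R)%:C%C =
  T%:R^-1 * \tr (qa_rho A *m
     \sum_i center (accept_mx R (qa_gates A) (qa_out A)) (ys i)).
Proof.
move=> hA T0; rewrite empirical_mean -mulr_suml rmorphB !rmorphM /= !fmorphV /= !rmorph_nat.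
rewrite !rmorph_sum /=.
under eq_bigr do rewrite accept_probE //.
under [X in _ - X / _]eq_bigr do rewrite accept_probE //.
have trS (I : finType) (F : I -> qop R (qa_adv A)) :
    \sum_i \tr (qa_rho A *m F i) = \tr (qa_rho A *m \sum_i F i).
  by rewrite mulmx_sumr raddf_sum.
rewrite !trS /center sumrB sumr_const card_ord.
rewrite -(scaler_nat _ (_ *: _)) scalerA mulmxBr -scalemxAr raddfB /= mxtraceZ mulrBr.
rewrite (_ : #|bits n| = (2 ^ n)%N); last by rewrite card_ffun card_bool card_ord.
rewrite mulrA mulrA mulVf ?mul1r 1?[_ / _]mulrC // pnatr_eq0 -lt0n //.
Qed.

End EmpiricalDistribution.

Lemma qdimE n : qdim n = (2 ^ n)%N.
Proof. by rewrite /qdim card_ffun card_bool card_ord. Qed.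

(** One sample serves all circuit codes by [good_sample], and [trace_pow2_bound] then covers every
    advice state at once. The power of [T] on the left clears the 1/T of the empirical mean. *)
Lemma exists_fooling_sample (R : realType) n s k T : (0 < T)%N ->
  exists ys : {ffun 'I_T -> bits n}, forall A : qalg R n,
    qalg_wf A -> (qalg_size A <= s)%N ->
    `|\sum_y empirical R ys y * accept_prob A y
       - \sum_y accept_prob A y / (2 ^ n)%:R| ^+ (2 ^ k).*2 * T%:R ^+ (2 ^ k).*2 <=
    ((n + s.*2).+1 ^ (s.*2 + 3) * (T ^ (2 ^ k) * (2 ^ k) ^ (2 ^ k).*2 * 2 ^ s)
      * 2 ^ (2 ^ k).*2)%:R.
Proof.
move=> T0.
pose M (c : circuit_code n s) : bits n -> qop R (tag c) :=
  accept_mx R (gates_of_code (tagged (tagged c)).2) (tagged (tagged c)).1.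
have [|c|c y|c y|ys hys] := @good_sample R (bits n) (circuit_code n s)
  (fun c => qdim (tag c)) (2 ^ s) M (2 ^ k) T [ffun=> false].
- by rewrite expn_gt0.
- by rewrite qdimE leq_exp2l // -ltnS ltn_ord.
- exact: accept_mx_adj.
- by apply: accept_mx_bounded; apply: gates_of_code_wf.
exists ys => -[a m gs o rho] [/= hgs hA]; rewrite /qalg_size /= => hs.
have := @empirical_advantage R n T ys (QAlg gs o rho) hA T0.
set delta := (X in X%:C%C) => /= e.
have ha : (a < s.+1)%N by lia.
have hm : (m < s.+1)%N by lia.
have [|t ht] := gates_of_code_surj (s := s) hgs; first by lia.
have /= := hys (existT (fun a : 'I_s.+1 =>
    {m : 'I_s.+1 & output_gates_code (a + (n + m)) s}) (Ordinal ha)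
  (existT (fun m : 'I_s.+1 => output_gates_code (a + (n + m)) s)
    (Ordinal hm) (o, t))).
rewrite /M /= ht; set S := \sum_i _ => hS.
have [hh [hp htr]] := hA.
have hherm : S^H = S by apply: adj_sum_center => z; apply: accept_mx_adj.
(* The exponent [k.+1] is chosen because 2^(k+1) is the [p.*2] of [good_sample] for p = 2^k. *)
have := @trace_pow2_bound _ _ rho S k.+1 hp hh htr hherm isT.
rewrite expnS mul2n => h.
have hT : T%:R != 0 :> R[i] by rewrite pnatr_eq0 -lt0n.
have e' : \tr (rho *m S) = (delta * T%:R)%:C%C.
  by rewrite rmorphM /= rmorph_nat e mulrC mulVKf.
move: h; rewrite e' normc_def /= expr0n addr0 sqrtr_sqr => h.
rewrite -exprMn -{1}[T%:R]ger0_norm ?ler0n // -normrM -lecR rmorphXn /= rmorph_nat.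
apply: le_trans h _; apply: le_trans hS _.
rewrite [leRHS]natrM natrX ler_wpM2r ?exprn_ge0 ?ler0n // ler_nat leq_mul2r.
by rewrite card_circuit_code orbT.
Qed.

(** * Asymptotics *)

(** With x = 2^r, the base is at most 8x = 2^(r+3), and (r + 3)(2x + 3) + x <= 32 x^2 <= x^3. Hence
    the number of circuits times the advice dimension costs only 2^p for p = 2^(3r). *)
Lemma circuit_count_bound n r : (4 < r)%N -> (n < 10 * r.+1)%N ->
  ((n + (2 ^ r).*2).+1 ^ ((2 ^ r).*2 + 3) * 2 ^ (2 ^ r) <= 2 ^ (2 ^ (3 * r)))%N.
Proof.
move=> r4 hn.
have h4 : (10 * r.+1 <= 2 ^ r.+2)%N.
  elim: r r4 {hn} => // r IH; rewrite ltnS leq_eqVlt => /orP[/eqP <- //|/IH].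
  rewrite [(2 ^ r.+3)%N]expnS; lia.
have x32 : (32 <= 2 ^ r)%N by rewrite (@leq_exp2l 2 5).
have rx : (r < 2 ^ r)%N by apply: ltn_expl.
have e1 : (2 ^ r.+2 = 4 * 2 ^ r)%N by rewrite !expnS; lia.
have e2 : (2 ^ (r + 3) = 8 * 2 ^ r)%N by rewrite expnD; lia.
have base : ((n + (2 ^ r).*2).+1 <= 2 ^ (r + 3))%N by lia.
apply: (@leq_trans ((2 ^ (r + 3)) ^ ((2 ^ r).*2 + 3) * 2 ^ (2 ^ r))).
  by rewrite leq_mul2r leq_exp2r ?base ?orbT // addn3.
rewrite -expnM -expnD leq_exp2l // [(3 * r)%N]mulnC expnM.
move: (2 ^ r)%N x32 rx {hn h4 e1 e2 base} => x x32 rx.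
rewrite !expnS expn0 muln1.
have : ((r + 3) * (x.*2 + 3) + x <= x * (x * 32))%N by nia.
nia.
Qed.

(** With p = 2^(3r), T is exactly 2 * (p^2 * 2^2 * (2^r)^2). To the power p, the factor p^2 pays for
    the words, 2^2 for the norm of the centered matrices, (2^r)^2 for the target advantage, and the
    leading 2 for [circuit_count_bound]. *)
Lemma small_advantage (R : realType) n r (T := (2 ^ (8 * r + 3))%N) :
  (4 < r)%N -> (n < 10 * r.+1)%N -> forall delta : R,
  `|delta| ^+ (2 ^ (3 * r)).*2 * T%:R ^+ (2 ^ (3 * r)).*2 <=
    ((n + (2 ^ r).*2).+1 ^ ((2 ^ r).*2 + 3) *
      (T ^ (2 ^ (3 * r)) * (2 ^ (3 * r)) ^ (2 ^ (3 * r)).*2 * 2 ^ (2 ^ r))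
      * 2 ^ (2 ^ (3 * r)).*2)%:R ->
  `|delta| <= (2 ^ r)%:R^-1.
Proof.
move=> r4 hn delta; set p := (2 ^ (3 * r))%N => h.
have r0 : 0 < (2 ^ r)%:R :> R by rewrite ltr0n expn_gt0.
have T0 : 0 < T%:R :> R by rewrite ltr0n expn_gt0.
have p0 : (0 < p.*2)%N by rewrite double_gt0 expn_gt0.
rewrite -[leRHS]mul1r ler_pdivlMr // -(@ler_pXn2r _ p.*2) ?nnegrE ?mulr_ge0 ?ler0n //.
rewrite expr1n -(ler_pM2r (exprn_gt0 p.*2 T0)) mul1r exprMn mulrAC.
apply: le_trans (ler_wpM2r _ h) _; first by rewrite exprn_ge0 ?ler0n.
rewrite -!natrX -natrM ler_nat.
have c := circuit_count_bound r4 hn; rewrite -/p in c.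
have TE : T = (2 * (p ^ 2 * 2 ^ 2 * (2 ^ r) ^ 2))%N.
  by rewrite /T /p -!expnM -!expnD -expnS; congr (2 ^ _)%N; lia.
move: (_ ^ (_ + 3))%N c => K c.
apply: (@leq_trans ((K * 2 ^ 2 ^ r) * (T ^ p * (p ^ 2 * 2 ^ 2 * (2 ^ r) ^ 2) ^ p))).
  by rewrite -mul2n !expnM !expnMn; lia.
apply: leq_trans (leq_mul c (leqnn _)) _.
by rewrite mulnCA -expnMn -TE -mul2n mulnC expnM expnAC -expnMn.
Qed.

(** For i = j./2 and x = 2^i one has j + 1 <= 2x and 2c <= i < x, so c (j + 1) <= x^2 <= 2^j. *)
Lemma mul_succ_leq_exp2 c j : (4 * c <= j)%N -> (c * j.+1 <= 2 ^ j)%N.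
Proof.
move=> hj; have := odd_double_half j; set i := j./2 => e.
have hi : (i < 2 ^ i)%N by apply: ltn_expl.
apply: (@leq_trans (2 ^ i.*2)); last by rewrite leq_exp2l // -e leq_addl.
rewrite -muln2 expnM; move: (2 ^ i)%N hi => x hi.
have : (odd j <= 1)%N by case: odd.
move=> ho; rewrite expnS expn1; nia.
Qed.

Lemma poly_lt_exp2 k : exists N, forall n, (N <= n)%N ->
  (n.+2 ^ k < 2 ^ (n %/ 10))%N.
Proof.
(* The threshold gives j >= 4 * (20 * k.+1), as [mul_succ_leq_exp2] asks; then n + 2 <= 20 (k + 1)(j
   + 1) <= 2^j, and jk < r. *)
exists (10 * (k.+1 * (4 * (20 * k.+1)).+1))%N => n hn.
set r := (n %/ 10)%N; set j := (r %/ k.+1)%N.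
have nr : (n < 10 * r.+1)%N by rewrite mulnC ltn_ceil.
have rj : (r < k.+1 * j.+1)%N by rewrite mulnC ltn_ceil.
have hr : (k.+1 * (4 * (20 * k.+1)).+1 <= r)%N by rewrite /r leq_divRL // mulnC.
have hj : ((4 * (20 * k.+1)).+1 <= j)%N by rewrite /j leq_divRL // mulnC.
have := mul_succ_leq_exp2 (ltnW hj) => h.
have h2 : (n.+2 <= 2 ^ j)%N by nia.
apply: (@leq_ltn_trans ((2 ^ j) ^ k)).
  by have [->//|k0] := posnP k; rewrite leq_exp2r.
rewrite -expnM ltn_exp2l //.
have := leq_divM r k.+1; rewrite -/j; nia.
Qed.

Theorem theorem3p2 (R : realType) :
  exists D : forall n : nat, {ffun bits n -> R},
    (forall n, distribution (D n)) /\
    @negligible R (fun n => #|supp (D n)|%:R / (2 ^ n)%:R) /\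
    (forall Af : forall n, qalg R n, nu_qpt Af ->
      @negligible R (fun n =>
        \sum_(y : bits n) D n y * accept_prob (Af n) y
        - \sum_(y : bits n) accept_prob (Af n) y / (2 ^ n)%:R)).
Proof.
(* With r = n %/ 10, 2^r outgrows every polynomial, while T * 2^r = 2^(9r+3) stays below 2^(10r) <=
   2^n once r >= 4. *)
pose r n := (n %/ 10)%N; pose T n := (2 ^ (8 * r n + 3))%N.
have T0 n : (0 < T n)%N by rewrite expn_gt0.
(* Choice fixes one sample for each [n] before any distinguisher is given; it works against all of
   size at most 2^r. *)
pose sample n := boolp.cid
  (@exists_fooling_sample R n (2 ^ r n) (3 * r n) (T n) (T0 n)).
have hr n : (n < 10 * (r n).+1)%N by rewrite mulnC ltn_ceil.
have r_ge m n : (10 * m <= n)%N -> (m <= r n)%N by rewrite leq_divRL // mulnC.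
have exp_gt0 m : 0 < (2 ^ m)%:R :> R by rewrite ltr0n expn_gt0.
exists (fun n => empirical R (sval (sample n))); split; [|split].
- by move=> n; apply: empirical_distribution.
- move=> c; have [N hN] := poly_lt_exp2 c; exists (N + 40)%N => n hn.
  have n0 : (0 < n)%N by lia.
  have r4 : (4 <= r n)%N by apply: r_ge; lia.
  have nc : (n ^ c <= 2 ^ r n)%N.
    apply: ltnW; apply: leq_ltn_trans (hN n _); last by lia.
    by have [->//|c0] := posnP c; rewrite leq_exp2r // -addn2 leq_addr.
  have := card_supp_empirical R (sval (sample n)).
  move: #|_| => m hm.
  rewrite ger0_norm ?divr_ge0 ?ler0n // ltr_pdivrMr // -natrX.
  rewrite mulrC ltr_pdivlMr ?ltr0n ?expn_gt0 ?n0 // -natrM ltr_nat.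
  apply: (@leq_ltn_trans (T n * 2 ^ r n)).
    exact: leq_mul.
  rewrite -expnD ltn_exp2l //.
  have h10 : (r n * 10 <= n)%N by apply: leq_divM.
  by move: (r n) r4 h10 => x; lia.
move=> Af [hwf [k hk]] c.
(* [N] makes the advantage bound 2^(-r) smaller than n^(-c), [N'] brings the polynomial size below
   2^r, and the 50 added below ensures r >= 5. *)
have [N hN] := poly_lt_exp2 c; have [N' hN'] := poly_lt_exp2 k.
exists (N + N' + 50)%N => n hn.
have n0 : (0 < n)%N by lia.
have r5 : (5 <= r n)%N by apply: r_ge; lia.
have nc : (n ^ c < 2 ^ r n)%N.
  apply: leq_ltn_trans (hN n _); last by lia.
  by have [->//|c0] := posnP c; rewrite leq_exp2r // -addn2 leq_addr.
have size_le : (qalg_size (Af n) <= 2 ^ r n)%N.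
  by apply: leq_trans (hk n) _; apply: ltnW; apply: hN'; lia.
have h := svalP (sample n) (Af n) (hwf n) size_le.
apply: le_lt_trans (small_advantage r5 (hr n) h) _.
by rewrite -natrX ltf_pV2 ?posrE ?ltr0n ?expn_gt0 ?n0 // ltr_nat.
Qed.
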